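(* Let $p/q$ be an even rational parameter, $\omega=p+q$, and let $B=[0,\omega]^2$ be the first block. Then there exists a plaid polygon contained in $B$ whose $x$-diameter is at least $\omega^2/(2q)-1$. Moreover, this polygon is invariant under reflection in the horizontal midline $y=\omega/2$ of $B$.
   Context: An even rational parameter is a rational $p/q\in(0,1)$, $p,q$ positive coprime integers, $pq$ even. Put $\omega=p+q$, $P=2p/\omega$, $Q=2q/\omega$. Line families: $\mathcal H$ = lines $y=n$, $\mathcal V$ = lines $x=n$ ($n\in\mathbb Z$), $\mathcal P$ = lines of slope $-P$ with integer $y$-intercept, $\mathcal Q$ = lines of slope $-Q$ with integer $y$-intercept. Functions mod $2\mathbb Z$, values represented in $(-1,1]$: $F_H=2Py$, $F_V=2Px$, $F_P=Py+P^2x+1$, $F_Q=Py+PQx+1$. A unit segment is an edge of a unit square of the integer grid; horizontal ones lie on $\mathcal H$-lines (set $A=H$), vertical ones on $\mathcal V$-lines ($A=V$). A point $z$ of a unit segment $s$ is a light point of $s$ if for some $B'\in\{P,Q\}$, $z$ lies on a line of $\mathcal B'$, $F_A(z)F_{B'}(z)>0$ and $|F_{B'}(z)|<|F_A(z)|$. The light count of $s$ is the number of distinct light points of $s$, a light point that is the midpoint of a horizontal $s$ counted twice; $s$ is good if its light count is $1$. In each unit square draw the segments joining its center to the midpoints of its good edges; plaid polygons are the connected components of the union of all these segments. The $x$-diameter of a planar set is the diameter of its projection to the $x$-axis. *)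

(* Defs.v *)
From HB Require Import structures.
From mathcomp Require Import all_boot all_order all_algebra.
From mathcomp Require Import all_classical all_reals all_analysis.
From mathcomp Require Import finmap.
Set Implicit Arguments. Unset Strict Implicit. Unset Printing Implicit Defensive.
Import Order.TTheory GRing.Theory Num.Theory.
Import numFieldNormedType.Exports.
Local Open Scope classical_set_scope.
Local Open Scope ring_scope.

Section Plaid.
Variable R : realType.
Variables p q : nat.

Definition omega : R := (p + q)%:R.
Definition PP : R := 2 * p%:R / omega.
Definition QQ : R := 2 * q%:R / omega.

(* representative of t mod 2Z in (-1,1] *)
Definition mod2 (t : R) : R := t - 2 * (Num.ceil ((t - 1) / 2))%:~R.

Definition F_H (z : R * R) : R := mod2 (2 * PP * z.2).
Definition F_V (z : R * R) : R := mod2 (2 * PP * z.1).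
Definition F_P (z : R * R) : R := mod2 (PP * z.2 + PP ^+ 2 * z.1 + 1).
Definition F_Q (z : R * R) : R := mod2 (PP * z.2 + PP * QQ * z.1 + 1).

Definition is_intR (x : R) := exists k : int, x = k%:~R.
(* z lies on a line of slope -s with integer y-intercept *)
Definition on_line_slope (s : R) (z : R * R) := is_intR (z.2 + s * z.1).

Inductive useg := Hseg of int & int | Vseg of int & int.

Definition on_seg (s : useg) (z : R * R) : Prop :=
  match s with
  | Hseg m n => z.2 = n%:~R /\ m%:~R <= z.1 <= m%:~R + 1
  | Vseg m n => z.1 = m%:~R /\ n%:~R <= z.2 <= n%:~R + 1
  end.

Definition is_horizontal (s : useg) : bool :=
  if s is Hseg _ _ then true else false.

Definition midpoint (s : useg) : R * R :=
  match s with
  | Hseg m n => (m%:~R + 2^-1, n%:~R)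
  | Vseg m n => (m%:~R, n%:~R + 2^-1)
  end.

Definition F_A (s : useg) : R * R -> R :=
  if is_horizontal s then F_H else F_V.

Definition light_point (s : useg) (z : R * R) : Prop :=
  on_seg s z /\
  ((on_line_slope PP z /\ 0 < F_A s z * F_P z /\ `|F_P z| < `|F_A s z|) \/
   (on_line_slope QQ z /\ 0 < F_A s z * F_Q z /\ `|F_Q z| < `|F_A s z|)).

Definition light_count (s : useg) : nat :=
  (#|` fset_set (light_point s)|%fset +
   (is_horizontal s && `[< light_point s (midpoint s) >]))%N.

Definition good (s : useg) : Prop := light_count s = 1%N.

Definition center (m n : int) : R * R := (m%:~R + 2^-1, n%:~R + 2^-1).
Definition edge_of (m n : int) (s : useg) : Prop :=
  s = Hseg m n \/ s = Hseg m (n + 1) \/ s = Vseg m n \/ s = Vseg (m + 1) n.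

Definition closed_segment (a b : R * R) : set (R * R) :=
  [set z | exists2 t : R, 0 <= t <= 1 &
     z = ((1 - t) * a.1 + t * b.1, (1 - t) * a.2 + t * b.2)].

Definition plaid_union : set (R * R) :=
  [set z | exists m n : int, exists2 s : useg, edge_of m n s /\ good s &
     closed_segment (center m n) (midpoint s) z].

Definition plaid_polygon (C : set (R * R)) : Prop :=
  exists2 x, plaid_union x & C = connected_component plaid_union x.

Definition first_block : set (R * R) :=
  [set z | 0 <= z.1 <= omega /\ 0 <= z.2 <= omega].

Definition x_diameter (C : set (R * R)) : \bar R :=
  ereal_sup [set (`|z.1 - w.1|)%:E | z in C & w in C].

End Plaid.

(* Main.v *)
Require Import Defs.
From HB Require Import structures.
From mathcomp Require Import all_boot all_order all_algebra.
From mathcomp Require Import all_classical all_reals all_analysis.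
From mathcomp Require Import finmap zify ring lra.
Import Order.TTheory GRing.Theory Num.Theory.
Import numFieldNormedType.Exports.
Set Implicit Arguments. Unset Strict Implicit. Unset Printing Implicit Defensive.
Local Open Scope classical_set_scope.
Local Open Scope ring_scope.

(**
All the functions of the model take values in (1/w)Z, w = p + q, and each is
constant on the lines where it matters: [F_P] and [F_Q] equal (2pN + w)/w mod 2
on a slanted line of intercept N, while [F_H] and [F_V] equal 4pn/w on the n-th
grid line.  So a crossing of two such lines is light when an odd residue a mod
2w lies between 0 and an even residue b.  Modulo 2 this indicator is
u(a) + v(b) + floor((a - b)/2w); each edge of a square meets exactly two slanted
lines and each slanted line meets the boundary of the square twice, so in the
sum over the boundary u and v cancel and the floors pair up.  Hence every square
has an even number of good edges, and by induction on the rows (columns) a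
plaid polygon meets each grid line of the block an even number of times.

Take m with 2pm = 1 or -1 mod w and 0 < 2m < w.  The row y = m has light points
only at x = 0 and x = w^2/(2q), so the polygon through the first good edge
passes through the second one, which gives the diameter.  It then crosses the
column x = m, hence does so twice; this column has only two good edges, swapped
by the reflection, which preserves the model.  So the polygon meets its mirror
image and is equal to it.
*)

Lemma odd_abszD (x y : int) : odd `|(x + y)%R|%N = odd `|x|%N (+) odd `|y|%N.
Proof. lia. Qed.

(** * Residues modulo [2 * w] and the lightness of a crossing *)

Section Lit.
Variable w : int.
Hypothesis w_gt0 : 0 < w.

(* [centered_rep a / w] is [mod2 (a / w)]. *)
Definition centered_rep (a : int) : int := a + 2 * w * ((w - a) %/ (2 * w))%Z.

(** The light condition with denominators cleared: [a / w] is the value on the slanted line, [b / w]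
    the value on the grid line. *)
Definition lit (a b : int) : bool :=
  (0 < centered_rep b * centered_rep a) && (`|centered_rep a| < `|centered_rep b|).

Lemma centered_rep_bound a : - w < centered_rep a <= w.
Proof.
have w2 : 2 * w != 0 by lia.
have E := divz_eq (w - a) (2 * w).
have := modz_ge0 (w - a) w2; have := ltz_mod (w - a) w2.
rewrite /centered_rep; move: (_ %/ _)%Z (_ %% _)%Z E => d r E; nia.
Qed.

Lemma centered_rep_uniq a c d : - w < c <= w -> a = c + 2 * w * d -> centered_rep a = c.
Proof.
move=> cw Ea; have := centered_rep_bound a; rewrite /centered_rep; move: (_ %/ _)%Z => e.
rewrite Ea => H; have : e + d = 0 by nia.
by nia.
Qed.

Lemma centered_repE a : exists d, a = centered_rep a + 2 * w * d.
Proof. by exists (- ((w - a) %/ (2 * w))%Z); rewrite /centered_rep; ring. Qed.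

Lemma centered_rep_add a d : centered_rep (a + 2 * w * d) = centered_rep a.
Proof. by have [e {1}->] := centered_repE a; apply: (@centered_rep_uniq _ _ (e + d)); [exact: centered_rep_bound | ring]. Qed.

Lemma centered_rep_mul a : centered_rep (2 * w * a) = 0.
Proof. by apply: (@centered_rep_uniq _ _ a); [lia | ring]. Qed.

Lemma lit_add a b c d : lit (a + 2 * w * c) (b + 2 * w * d) = lit a b.
Proof. by rewrite /lit !centered_rep_add. Qed.

Lemma lit_capacity0 a b : centered_rep b = 0 -> lit a b = false.
Proof. by rewrite /lit => ->; rewrite mul0r ltxx. Qed.

Lemma lit_between a b : lit a b = (0 < centered_rep a < centered_rep b) || (centered_rep b < centered_rep a < 0).
Proof. rewrite /lit; move: (centered_rep a) (centered_rep b) => x y; nia. Qed.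

(* The symmetry a |-> b - a of the interval between 0 and b; it is behind both
   the reflection in the midline and the double count of midpoints. *)
Lemma lit_sym a a' b d : a + a' = b + 2 * w * d -> lit a b = lit a' b.
Proof.
suff H x y : (exists d, x + y = b + 2 * w * d) -> lit x b -> lit y b.
  by move=> E; apply/idP/idP; apply: H; exists d; lia.
case=> e E; rewrite !lit_between => L.
have [u Eu] := centered_repE x; have [v Ev] := centered_repE b; have bb := centered_rep_bound b.
have -> : centered_rep y = centered_rep b - centered_rep x; last by lia.
apply: (@centered_rep_uniq _ _ (e + v - u)); first by lia.
have -> : y = b + 2 * w * e - x by lia.
by rewrite {1}Ev {1}Eu; ring.
Qed.

(** Negation commutes with [centered_rep] except at [w], which represents its own opposite;
    [centered_rep a] is not [w], being smaller in absolute value than [centered_rep b]. *)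
Lemma lit_opp a b : centered_rep b != w -> lit a b -> lit (- a) (- b).
Proof.
rewrite !lit_between => bw L; have ba := centered_rep_bound a; have bb := centered_rep_bound b.
have [u Eu] := centered_repE a; have [v Ev] := centered_repE b.
rewrite (@centered_rep_uniq (- a) (- centered_rep a) (- u)); [|lia|lia].
by rewrite (@centered_rep_uniq (- b) (- centered_rep b) (- v)); lia.
Qed.

Definition floor_odd (x : int) : bool := odd `|(x %/ (2 * w))%Z|%N.

(** An odd [x] is no multiple of [2 * w], so floor(-t) = -floor(t) - 1 at t = x/2w. *)
Lemma floor_oddN x : odd `|x|%N -> floor_odd (- x) = ~~ floor_odd x.
Proof.
have w2 : 2 * w != 0 by lia.
move=> ox; rewrite /floor_odd.
have E := divz_eq x (2 * w); have E' := divz_eq (- x) (2 * w).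
have := modz_ge0 x w2; have := ltz_mod x w2.
have := modz_ge0 (- x) w2; have := ltz_mod (- x) w2.
move: (x %/ _)%Z (x %% _)%Z (- x %/ _)%Z (- x %% _)%Z E E' => d r d' r' E E' h1 h2 h3 h4.
have r0 : r != 0 by apply: contraTneq ox => r0; rewrite E r0; lia.
have : d + d' = -1 by nia.
lia.
Qed.

(** Let x, y be the representatives of [a], [b]. As x is odd and y even, x is neither 0 nor y, so
    betweenness is [x < 0] xor [x < y]; the bit [x < y] is the borrow in the floor of (a - b)/2w. *)
Lemma lit_parity a b : odd `|a|%N -> ~~ odd `|b|%N ->
  lit a b = ((centered_rep a < 0) (+) odd `|((w - a) %/ (2 * w))%Z|%N)
            (+) odd `|((w - b) %/ (2 * w))%Z|%N (+) floor_odd (a - b).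
Proof.
move=> oa eb; rewrite lit_between /floor_odd.
have [ra rb] : a = centered_rep a - 2 * w * ((w - a) %/ (2 * w))%Z /\ b = centered_rep b - 2 * w * ((w - b) %/ (2 * w))%Z.
  by rewrite /centered_rep; split; ring.
have ba := centered_rep_bound a; have bb := centered_rep_bound b.
have w2 : 2 * w != 0 by lia.
have E := divz_eq (a - b) (2 * w).
have := modz_ge0 (a - b) w2; have := ltz_mod (a - b) w2.
move: (centered_rep a) (centered_rep b) ((w - a) %/ _)%Z ((w - b) %/ _)%Z ((a - b) %/ _)%Z ((a - b) %% _)%Z ra rb ba bb E.
move=> x y u v d r Ea Eb hx hy E h1 h2.
have ox : odd `|x|%N by move: oa; rewrite Ea; lia.
have ey : ~~ odd `|y|%N by move: eb; rewrite Eb; lia.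
have Er : r = x - y - 2 * w * (u - v + d) by lia.
have -> : odd `|d|%N = (x < y)%R (+) odd `|u|%N (+) odd `|v|%N.
  have -> : d = v - u - (x < y)%R%:Z by have [xy|xy] := ltP x y => /=; nia.
  by rewrite !odd_abszD !abszN absz_nat oddb addbC [odd `|v|%N (+) _]addbC addbA.
have -> : (0 < x < y) || (y < x < 0) = (x < 0) (+) (x < y) by clear -ox ey; lia.
by case: (odd `|u|%N); case: (odd `|v|%N); case: (x < 0); case: (x < y).
Qed.

(** The terms in [c] alone cancel because both slanted lines cross the same grid line. [u] stays
    abstract: only its cancellation around a square matters. *)
Lemma lit_addb_parity : exists u : int -> bool, forall a b c,
  odd `|a|%N -> odd `|b|%N -> ~~ odd `|c|%N ->
  lit a c (+) lit b c = u a (+) u b (+) floor_odd (a - c) (+) floor_odd (b - c).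
Proof.
exists (fun a => (centered_rep a < 0) (+) odd `|((w - a) %/ (2 * w))%Z|%N) => a b c oa ob ec.
rewrite !lit_parity //.
have xor5 x y v f g : (x (+) v (+) f) (+) (y (+) v (+) g) = x (+) y (+) f (+) g.
  by case: x y v f g => [] [] [] [] [].
exact: xor5.
Qed.
End Lit.

(* [k] selects the squares of a polygon: it is constant across good edges.  In the
   sum over one row the vertical edges cancel in pairs, so consecutive rows have
   the same parity. *)
Lemma addb_line_even (N : nat) (k vgood hgood : nat -> nat -> bool) :
  (forall i j, (i < N)%N -> (j < N)%N ->
     vgood i j (+) vgood i.+1 j (+) hgood i j (+) hgood i j.+1 = false) ->
  (forall i j, (i.+1 < N)%N -> (j < N)%N -> vgood i.+1 j -> k i j = k i.+1 j) ->
  (forall i j, (i < N)%N -> (j.+1 < N)%N -> hgood i j.+1 -> k i j = k i j.+1) ->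
  (forall j, vgood 0%N j = false) -> (forall j, vgood N j = false) ->
  (forall i, hgood i 0%N = false) ->
  forall j, (j < N)%N -> \big[addb/false]_(i < N) (k i j && hgood i j) = false.
Proof.
move=> sq kV kH V0 VN H0; elim=> [_|j IH jN]; first by apply: big1 => i _; rewrite H0 andbF.
have jN' : (j < N)%N by exact: ltnW.
have S0 : \big[addb/false]_(i < N)
    (k i j && (vgood i j (+) vgood i.+1 j (+) hgood i j (+) hgood i j.+1)) = false.
  by apply: big1 => i _; rewrite sq ?andbF.
have SV : \big[addb/false]_(i < N) (k i j && vgood i j) =
          \big[addb/false]_(i < N) (k i j && vgood i.+1 j).
  move: kV VN jN'; case: (N) => [|M] kV VM jM; first by rewrite !big_ord0.
  rewrite big_ord_recl big_ord_recr /= V0 VM !andbF addbF /=.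
  apply: eq_bigr => i _; rewrite /bump /= add1n.
  case: (boolP (vgood i.+1 j)) => [g|_]; last by rewrite !andbF.
  by rewrite (kV i j) //; exact: ltn_ord.
move: S0; under eq_bigr do rewrite !andb_addr.
rewrite !big_split /= SV addbb IH //= => S4; rewrite -[RHS]S4.
apply: eq_bigr => i _; case: (boolP (hgood i j.+1)) => [g|_]; last by rewrite !andbF.
by rewrite (kH i j).
Qed.

Lemma addb_big_other (N : nat) (F : 'I_N -> bool) (i : 'I_N) :
  \big[addb/false]_(j < N) F j = false -> F i -> exists2 j, j != i & F j.
Proof.
move=> S Fi; apply/exists_inP; apply: contraT; rewrite negb_exists_in => /forall_inP h.
by move: S; rewrite (bigD1 i) //= Fi big1 // => j ji; apply/negbTE/h.
Qed.

(** * Good edges in integer arithmetic *)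

Section Plaid.
Variables (p q : nat) (w : int).
Hypothesis w_def : w = p%:Z + q%:Z.
Hypothesis p_gt0 : 0 < p%:Z.
Hypothesis p_lt_q : p%:Z < q%:Z.
Hypothesis w_odd : odd `|w|%N.
(** Coprimality of p and w, as a cancellation rule. *)
Hypothesis w_dvd : forall a, (w %| p%:Z * a)%Z -> (w %| a)%Z.

Let w_gt0 : 0 < w. Proof. by rewrite w_def; lia. Qed.

(* The values, times w, of [F_P] and [F_Q] on a slanted line of intercept N, and of
   [F_H], [F_V] on the n-th horizontal or vertical line. *)
Definition mass (N : int) : int := 2 * p%:Z * N + w.
Definition capacity (n : int) : int := 4 * p%:Z * n.

Lemma odd_mass N : odd `|mass N|%N.
Proof. by rewrite /mass; lia. Qed.

Lemma even_capacity n : ~~ odd `|capacity n|%N.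
Proof. by rewrite /capacity; lia. Qed.

Lemma capacity_rep0 n : (w %| n)%Z -> centered_rep w (capacity n) = 0.
Proof.
case/dvdzP=> d ->; rewrite /capacity.
have -> : 4 * p%:Z * (d * w) = 2 * w * (2 * p%:Z * d) by ring.
exact: centered_rep_mul.
Qed.

Lemma dvd_mul2p a : (w %| 2 * p%:Z * a)%Z -> (w %| a)%Z.
Proof.
move=> H; apply: w_dvd; case/dvdzP: H => d E.
apply/dvdzP; exists (d %/ 2)%Z.
have od : ~~ odd `|d|%N.
  have : odd `|(d * w)%R|%N = odd `|(2 * (p%:Z * a))%R|%N by rewrite -E mulrA.
  by rewrite !abszM !oddM w_odd andbT /= => ->.
have ed : d = 2 * (d %/ 2)%Z by lia.
by move: E; rewrite {1}ed; lia.
Qed.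

(** The floor of mP, where mP is the intercept of the line of slope -P through (m, 0). As P + Q = 2,
    mQ = 2m - mP, so one quotient and remainder serve both slanted families. *)
Definition column_quo (m : int) : int := (2 * p%:Z * m %/ w)%Z.
Definition column_rem (m : int) : int := (2 * p%:Z * m %% w)%Z.

Lemma column_quo_rem m : 2 * p%:Z * m = column_quo m * w + column_rem m /\ 0 <= column_rem m < w.
Proof.
have w0 : w != 0 by lia.
split; first exact: divz_eq.
have := modz_ge0 (2 * p%:Z * m) w0; have := ltz_mod (2 * p%:Z * m) w0; rewrite /column_rem; lia.
Qed.

(* A vertical edge meets one line of each slope.  A horizontal edge meets two Q-lines
   in the first case and one line of each slope in the second.  In the columns
   m = 0 and m = w - 1, where slanted lines pass through corners, the first case
   still counts every light point once. *)
Definition vgood (m n : int) : bool :=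
  lit w (mass (n + column_quo m + 1)) (capacity m) (+) lit w (mass (n + 2 * m - column_quo m)) (capacity m).

Definition hgood (m n : int) : bool :=
  if column_rem m <= w - 2 * p%:Z then
    lit w (mass (n + 2 * m - column_quo m)) (capacity n) (+) lit w (mass (n + 2 * m - column_quo m + 1)) (capacity n)
  else lit w (mass (n + column_quo m + 1)) (capacity n) (+) lit w (mass (n + 2 * m - column_quo m)) (capacity n).

(** Since p < q, 2p < w and the quotient grows by at most one per column. *)
Lemma column_quo_next m : column_quo (m + 1) = if column_rem m < w - 2 * p%:Z then column_quo m else column_quo m + 1.
Proof.
have [E rb] := column_quo_rem m; have [E' rb'] := column_quo_rem (m + 1).
have {}E' : column_quo m * w + column_rem m + 2 * p%:Z = column_quo (m + 1) * w + column_rem (m + 1) by lia.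
case: ltP => h.
  have : column_quo (m + 1) - column_quo m = 0 by nia.
  lia.
have : column_quo (m + 1) - column_quo m = 1 by nia.
lia.
Qed.

Lemma column_rem_max m : column_rem m = w - 2 * p%:Z -> (w %| m + 1)%Z.
Proof.
move=> E; apply: dvd_mul2p; apply/dvdzP; exists (column_quo m + 1).
by have [F _] := column_quo_rem m; rewrite mulrDr F E; ring.
Qed.

Lemma square_even m n : vgood m n (+) vgood (m + 1) n (+) hgood m n (+) hgood m (n + 1) = false.
Proof.
(* The right edge in terms of the quotient of column m, split as in [hgood]; in the borderline case
   its capacity is 0 and both sides are false. *)
have Vright : vgood (m + 1) n =
   if column_rem m <= w - 2 * p%:Z then lit w (mass (n + column_quo m + 1)) (capacity (m + 1)) (+) lit w (mass (n + 2 * m - column_quo m + 2)) (capacity (m + 1))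
   else lit w (mass (n + column_quo m + 2)) (capacity (m + 1)) (+) lit w (mass (n + 2 * m - column_quo m + 1)) (capacity (m + 1)).
  rewrite /vgood column_quo_next; case: ltgtP => h.
  - by congr (lit _ (mass _) _ (+) lit _ (mass _) _); ring.
  - by congr (lit _ (mass _) _ (+) lit _ (mass _) _); ring.
  - by rewrite !(lit_capacity0 _ (capacity_rep0 (column_rem_max h))).
rewrite {}Vright /vgood /hgood; move: (column_quo m) => k.
have e1 : n + 1 + 2 * m - k = n + 2 * m - k + 1 by ring.
have e2 : n + 2 * m - k + 1 + 1 = n + 2 * m - k + 2 by ring.
have e3 : n + 1 + k + 1 = n + k + 2 by ring.
have ec a : capacity (a + 1) = capacity a + 4 * p%:Z by rewrite /capacity; ring.
have P2 : mass (n + k + 2) = mass (n + k + 1) + 2 * p%:Z by rewrite /mass; ring.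
have Q1 : mass (n + 2 * m - k + 1) = mass (n + 2 * m - k) + 2 * p%:Z by rewrite /mass; ring.
have Q2 : mass (n + 2 * m - k + 2) = mass (n + 2 * m - k) + 4 * p%:Z by rewrite /mass; ring.
(* The intercepts n + k + 1 and n + 2m - k of the P-line and the Q-line add up to 2m + 2n + 1. *)
have P1 : mass (n + k + 1) = capacity m + capacity n + 2 * p%:Z + w * 2 - mass (n + 2 * m - k) by rewrite /mass /capacity; ring.
have [u uE] := lit_addb_parity w_gt0.
rewrite e1 e2 e3 !uE ?odd_mass ?even_capacity //.
have fshift a : floor_odd w (a + w * 2) = ~~ floor_odd w a.
  rewrite /floor_odd; have -> : a + w * 2 = 1 * (2 * w) + a by ring.
  by rewrite divzMDl; [rewrite odd_abszD | lia].
have fN := floor_oddN w_gt0.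
(* p1 is the reflection of q0, so the floors pair up as [floor_odd x] and
   [floor_odd (- x)]. *)
set A := capacity m in P1 *; set B := capacity n in P1 *; set q0 := mass (n + 2 * m - k) in P1 Q1 Q2 *.
have oA : ~~ odd `|A|%N by exact: even_capacity.
have oB : ~~ odd `|B|%N by exact: even_capacity.
have oq : odd `|q0|%N by exact: odd_mass.
have rfl a b : odd `|b|%N -> a = - b + w * 2 -> floor_odd w a = floor_odd w b.
  by move=> ob ->; rewrite fshift fN // negbK.
rewrite !ec -/A -/B P2 Q1 Q2 P1.
set p1 := _ + _ - q0.
have -> : floor_odd w (p1 - A) = floor_odd w (q0 - B - 2 * p%:Z) by apply: rfl; [clear -oq oB; lia | rewrite /p1; ring].
have -> : floor_odd w (p1 - (A + 4 * p%:Z)) = floor_odd w (q0 - B + 2 * p%:Z) by apply: rfl; [clear -oq oB; lia | rewrite /p1; ring].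
have -> : floor_odd w (p1 - B) = floor_odd w (q0 - A - 2 * p%:Z) by apply: rfl; [clear -oq oA; lia | rewrite /p1; ring].
have -> : floor_odd w (p1 + 2 * p%:Z - (B + 4 * p%:Z)) = floor_odd w (q0 - A) by apply: rfl; [clear -oq oA; lia | rewrite /p1; ring].
have -> : floor_odd w (p1 + 2 * p%:Z - (A + 4 * p%:Z)) = floor_odd w (q0 - B) by apply: rfl; [clear -oq oB; lia | rewrite /p1; ring].
have -> : q0 + 2 * p%:Z - B = q0 - B + 2 * p%:Z by ring.
have -> : q0 + 2 * p%:Z - (B + 4 * p%:Z) = q0 - B - 2 * p%:Z by ring.
have -> : q0 + 2 * p%:Z - (A + 4 * p%:Z) = q0 - A - 2 * p%:Z by ring.
have -> : q0 + 4 * p%:Z - (B + 4 * p%:Z) = q0 - B by ring.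
have -> : q0 + 4 * p%:Z - (A + 4 * p%:Z) = q0 - A by ring.
(* In either case every value of [u] and every floor now occurs exactly twice. *)
by case: ifP => _; do 4!move: (u _); do 4!move: (floor_odd w _); clear; do 8!case.
Qed.

(** The P-line of intercept n + N meets y = n at x = Nw/2p, and the inequalities place this in
    [m, m + 1]. The second alternative, and equality in the first, are crossings at corners. *)
Lemma cross_Hp (m N : int) :
  2 * p%:Z * m <= N * w <= 2 * p%:Z * (m + 1) <->
  (N = column_quo m + 1 /\ w - 2 * p%:Z <= column_rem m) \/ (N = column_quo m /\ column_rem m = 0).
Proof.
have [E rb] := column_quo_rem m.
have {E} -> : 2 * p%:Z * (m + 1) = column_quo m * w + column_rem m + 2 * p%:Z by lia.
rewrite (proj1 (column_quo_rem m)); split=> [H|[[-> h]|[-> h]]]; try by lia.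
have [h|h|h] := ltgtP (N - column_quo m) 1.
- have : N - column_quo m = 0 by nia.
  nia.
- nia.
- left; split; [lia | nia].
Qed.

Lemma cross_Hq (m N : int) :
  2 * q%:Z * m <= N * w <= 2 * q%:Z * (m + 1) <->
  N = 2 * m - column_quo m \/ (N = 2 * m - column_quo m + 1 /\ column_rem m <= w - 2 * p%:Z).
Proof.
have [E rb] := column_quo_rem m.
have E1 : 2 * q%:Z * m = (2 * m - column_quo m) * w - column_rem m by rewrite w_def in E *; lia.
have -> : 2 * q%:Z * (m + 1) = (2 * m - column_quo m) * w - column_rem m + 2 * w - 2 * p%:Z by lia.
rewrite {}E1; move: (2 * m - column_quo m) => k; split=> [H|[->|[-> h]]]; try by lia.
have [h|h|h] := ltgtP (N - k) 0.
- nia.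
- have : N - k = 1 by nia.
  by right; split; nia.
- by left; lia.
Qed.

(** The P-line of intercept n + N meets x = m at height N - mP above n, here multiplied by w. *)
Lemma cross_Vp (m N : int) :
  0 <= N * w - 2 * p%:Z * m <= w <-> N = column_quo m + 1 \/ (N = column_quo m /\ column_rem m = 0).
Proof.
have [-> rb] := column_quo_rem m; split=> [H|[->|[-> h]]]; try by lia.
have [h|h|h] := ltgtP (N - column_quo m) 1.
- have : N - column_quo m = 0 by nia.
  by right; split; nia.
- nia.
- by left; lia.
Qed.

Lemma cross_Vq (m N : int) :
  0 <= N * w - 2 * q%:Z * m <= w <->
  N = 2 * m - column_quo m \/ (N = 2 * m - column_quo m + 1 /\ column_rem m = 0).
Proof.
have [E rb] := column_quo_rem m.
have -> : 2 * q%:Z * m = (2 * m - column_quo m) * w - column_rem m by rewrite w_def in E *; lia.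
move: (2 * m - column_quo m) => k; split=> [H|[->|[-> h]]]; try by lia.
have [h|h|h] := ltgtP (N - k) 0.
- nia.
- have : N - k = 1 by nia.
  by right; split; nia.
- by left; lia.
Qed.

Lemma column_rem_eq0 (m : int) : column_rem m = 0 <-> (w %| m)%Z.
Proof.
have [E rb] := column_quo_rem m; split=> [h|/dvdzP[d Ed]].
  by apply: dvd_mul2p; apply/dvdzP; exists (column_quo m); lia.
have {}E : (2 * p%:Z * d - column_quo m) * w = column_rem m by rewrite Ed in E *; lia.
move: (2 * p%:Z * d - column_quo m) E => e Ee; rewrite -Ee in rb *.
have -> : e = 0 by clear -rb w_gt0; nia.
exact: mul0r.
Qed.

(** * Grid lines whose capacity is 2 or -2 modulo [2 * w] *)

Section Capacity2.
Variables (n d eps : int).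
Hypothesis eps1 : eps = 1 \/ eps = -1.
Hypothesis n_def : 2 * p%:Z * n = eps + w * d.

Let w_gt2 : 2 < w.
Proof. by have := w_odd; lia. Qed.

Lemma rep_capacity2 : centered_rep w (capacity n) = 2 * eps.
Proof.
apply: (@centered_rep_uniq w w_gt0 _ _ d); first by lia.
have -> : capacity n = 2 * (2 * p%:Z * n) by rewrite /capacity; ring.
by rewrite n_def; ring.
Qed.

(** The only odd number strictly between 0 and [2 * eps] is [eps], and [mass n] is congruent to
    [eps] because [d] is odd. Cancelling 2p leaves a congruence of intercepts. *)
Lemma lit_capacity2 (N : int) : lit w (mass N) (capacity n) = (w %| N - n)%Z.
Proof.
have [e E] := centered_repE w (mass N); have om := odd_mass N.
apply/idP/dvdzP => [|[c Ec]].
  rewrite lit_between // rep_capacity2 => L.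
  have {}L : centered_rep w (mass N) = eps by lia.
  suff /dvdzP[c ->] : (w %| N - n)%Z by exists c.
  apply: dvd_mul2p; apply/dvdzP; exists (2 * e - d - 1).
  by rewrite L /mass in E; rewrite mulrBr n_def; lia.
have -> : N = n + c * w by lia.
have od : odd `|d|%N by have := n_def; lia.
rewrite lit_between // rep_capacity2 (@centered_rep_uniq w w_gt0 _ eps (((d + 1) %/ 2)%Z + p%:Z * c)) ; [lia|lia|].
have dE : d = 2 * ((d + 1) %/ 2)%Z - 1 by lia.
rewrite /mass mulrDr n_def {1}dE; ring.
Qed.

(** Light lines have intercept congruent to n modulo w. Among those counted by [hgood] in the block,
    only the Q-lines of offset 0 and w qualify; they meet y = n at x = 0 and x = w^2/2q. *)
Lemma hgood_capacity2 (m : int) : 0 <= m < w -> hgood m n -> m = 0 \/ m = (w * w %/ (2 * q%:Z))%Z.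
Proof.
move=> m_lt; rewrite /hgood.
have crossing N : 2 * q%:Z * m <= N * w <= 2 * q%:Z * (m + 1) -> (w %| N)%Z ->
    m = 0 \/ m = (w * w %/ (2 * q%:Z))%Z.
  move=> H /dvdzP[c Ec]; have Nw : c = 0 \/ c = 1.
    have : 0 <= N * w <= 2 * q%:Z * w by clear -H m_lt p_gt0 p_lt_q; nia.
    rewrite Ec => H'; have : 0 <= c < 2 by clear -H' w_def w_gt0 p_gt0 p_lt_q; nia.
    lia.
  case: Nw => c01; move: H; rewrite Ec c01; first by left; clear -H m_lt p_gt0 p_lt_q; nia.
  right; have q0 : 2 * q%:Z != 0 by lia.
  (* As w^2 is odd, w^2/2q is no integer, so the crossing is not a corner and m is its floor. *)
  have oww : odd `|(w * w)%R|%N by rewrite abszM oddM w_odd.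
  have := divz_eq (w * w) (2 * q%:Z); have := modz_ge0 (w * w) q0; have := ltz_mod (w * w) q0.
  move: (_ %/ _)%Z (_ %% _)%Z => a r.
  clear -H oww p_gt0 p_lt_q => h1 h2 E; rewrite mul1r in H.
  have : 2 * q%:Z * (m + 1) - w * w != 0 by lia.
  suff : m - a = 0 by lia.
  nia.
have Q0 : lit w (mass (n + 2 * m - column_quo m)) (capacity n) -> m = 0 \/ m = (w * w %/ (2 * q%:Z))%Z.
  rewrite lit_capacity2 (_ : _ - n = 2 * m - column_quo m); last by ring.
  by apply: crossing; apply/cross_Hq; left.
have addb_or a b : a (+) b -> a || b by case: a b => [] [].
case: ifP => h /addb_or/orP[] // ; rewrite lit_capacity2.
  rewrite (_ : _ - n = 2 * m - column_quo m + 1); last by ring.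
  by apply: crossing; apply/cross_Hq; right.
(* The offset of the P-line lies strictly between 0 and w. *)
rewrite (_ : _ - n = column_quo m + 1); last by ring.
case/dvdzP=> c Ec; exfalso.
have [E rb] := column_quo_rem m.
have k2p : column_quo m < 2 * p%:Z by clear -E rb p_gt0 m_lt w_gt0; nia.
have : 0 < (column_quo m + 1) * w < w * w by clear -k2p E rb w_def p_gt0 p_lt_q m_lt; nia.
rewrite Ec => H.
have : 0 < c < 1 by clear -H w_gt0; nia.
lia.
Qed.

(** The Q-line of offset 0, through (0, n), is light; the one of offset 1 is not. *)
Lemma hgood_capacity2_0 : hgood 0 n.
Proof.
have [k0 r0] : column_quo 0 = 0 /\ column_rem 0 = 0 by rewrite /column_quo /column_rem mulr0 div0z mod0z.
rewrite /hgood r0 k0 ifT; last by lia.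
rewrite !lit_capacity2 (_ : _ - n = 0) ?dvdz0; last by ring.
rewrite (_ : _ - n = 1) /=; last by ring.
apply/negP => /dvdzP[c Ec].
have : 0 < c < 1 by clear -Ec w_gt2; nia.
by lia.
Qed.

(** A light line of given slope fixes the height modulo w, and two of any three good edges owe their
    light point to the same slope. *)
Lemma vgood_capacity2 (j1 j2 j3 : int) : 0 <= j1 < w -> 0 <= j2 < w -> 0 <= j3 < w ->
  vgood n j1 -> vgood n j2 -> vgood n j3 -> [\/ j1 = j2, j1 = j3 | j2 = j3].
Proof.
have crossing j : vgood n j -> (w %| j + (column_quo n + 1 - n))%Z || (w %| j + (n - column_quo n))%Z.
  have -> : j + (column_quo n + 1 - n) = j + column_quo n + 1 - n by ring.
  have -> : j + (n - column_quo n) = j + 2 * n - column_quo n - n by ring.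
  by rewrite /vgood !lit_capacity2; case: (_ %| _)%Z.
have uniq a b c : 0 <= a < w -> 0 <= b < w -> (w %| a + c)%Z -> (w %| b + c)%Z -> a = b.
  move=> ha hb /dvdzP[e He] /dvdzP[f Hf].
  have E : a - b = (e - f) * w by rewrite mulrBl -He -Hf; ring.
  move: (e - f) E => g E; have g0 : g = 0 by clear -E ha hb w_gt0; nia.
  by move: E; rewrite g0; lia.
move=> h1 h2 h3 /crossing/orP[c1|c1] /crossing/orP[c2|c2] /crossing/orP[c3|c3];
  by [constructor 1; apply: uniq c1 c2 | constructor 2; apply: uniq c1 c3
     | constructor 3; apply: uniq c2 c3].
Qed.

End Capacity2.

Lemma hgood_capacity0 (m n : int) : (w %| n)%Z -> hgood m n = false.
Proof. by move/capacity_rep0=> h; rewrite /hgood !(lit_capacity0 _ h) if_same. Qed.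

Lemma vgood_capacity0 (m n : int) : (w %| m)%Z -> vgood m n = false.
Proof. by move/capacity_rep0=> h; rewrite /vgood !(lit_capacity0 _ h). Qed.

(** * Light points and good segments *)

Variable R : realType.
Local Notation W := (w%:~R : R).

Lemma W_gt0 : 0 < W. Proof. by rewrite ltr0z. Qed.

Lemma W_neq0 : W != 0. Proof. by rewrite gt_eqF ?W_gt0. Qed.

Lemma omegaE : omega R p q = W.
Proof. by rewrite /omega w_def natrD intrD. Qed.

Lemma mod2_rep (a : int) : mod2 (a%:~R / W) = (centered_rep w a)%:~R / W.
Proof.
have := centered_rep_bound w_gt0 a; have [d E] := centered_repE w a; move: (centered_rep w a) E => x -> hx.
rewrite /mod2 (@ceil_def _ _ d); last first.
  have -> : ((x + 2 * w * d)%:~R / W - 1) / 2 = (x%:~R / W - 1) / 2 + d%:~R.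
    by rewrite intrD !intrM; field; exact: W_neq0.
  have : -1 < (x%:~R : R) / W <= 1.
    rewrite ltr_pdivlMr ?W_gt0 // ler_pdivrMr ?W_gt0 // mulN1r mul1r -intrN ltr_int ler_int.
    by [].
  by rewrite intrB; lra.
by rewrite intrD !intrM; field; exact: W_neq0.
Qed.

Lemma litP (a b : int) :
  (0 < mod2 (b%:~R / W) * mod2 (a%:~R / W) /\ `|mod2 (a%:~R / W)| < `|mod2 (b%:~R / W)|)
  <-> lit w a b.
Proof.
have V0 : 0 < W^-1 by rewrite invr_gt0 W_gt0.
rewrite !mod2_rep /lit !normrM (gtr0_norm V0) ltr_pM2r // -!intr_norm ltr_int.
rewrite mulrACA (pmulr_lgt0 _ (mulr_gt0 V0 V0)) -intrM ltr0z.
by split=> [[-> ->]|/andP[]].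
Qed.

Lemma PPE : PP R p q = 2 * p%:R / W. Proof. by rewrite /PP omegaE. Qed.
Lemma QQE : QQ R p q = 2 * q%:R / W. Proof. by rewrite /QQ omegaE. Qed.

(** Before reduction modulo 2, [F_P] and [F_Q] are P(y + sx) + 1 with s = P or s = Q, hence constant
    on lines of slope -s. *)
Lemma mass_on_line (s : R) (z : R * R) (N : int) : z.2 + s * z.1 = N%:~R ->
  PP R p q * z.2 + PP R p q * s * z.1 + 1 = (mass N)%:~R / W.
Proof.
move=> E; rewrite -mulrA -mulrDr E PPE /mass intrD !intrM.
by field; exact: W_neq0.
Qed.

Lemma light_on_line (z : R * R) (a : int) (FA : R) : FA = mod2 (a%:~R / W) ->
  ((on_line_slope (PP R p q) z /\ 0 < FA * F_P p q z /\ `|F_P p q z| < `|FA|) \/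
   (on_line_slope (QQ R p q) z /\ 0 < FA * F_Q p q z /\ `|F_Q p q z| < `|FA|)) <->
  exists2 N : int, lit w (mass N) a &
    z.2 + PP R p q * z.1 = N%:~R \/ z.2 + QQ R p q * z.1 = N%:~R.
Proof.
move=> ->.
have FP N : z.2 + PP R p q * z.1 = N%:~R -> F_P p q z = mod2 ((mass N)%:~R / W).
  by move/mass_on_line; rewrite /F_P expr2 => ->.
have FQ N : z.2 + QQ R p q * z.1 = N%:~R -> F_Q p q z = mod2 ((mass N)%:~R / W).
  by move/mass_on_line; rewrite /F_Q => ->.
split=> [[[[N E]]|[[N E]]]|[N L [E|E]]].
- by rewrite (FP N) // => /litP L; exists N; [|left].
- by rewrite (FQ N) // => /litP L; exists N; [|right].
- by left; rewrite (FP N) //; split; [exists N | apply/litP].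
- by right; rewrite (FQ N) //; split; [exists N | apply/litP].
Qed.

Lemma F_HE (z : R * R) (n : int) : z.2 = n%:~R -> F_H p q z = mod2 ((capacity n)%:~R / W).
Proof.
move=> E; rewrite /F_H E PPE /capacity !intrM; congr mod2.
by field; exact: W_neq0.
Qed.

Lemma F_VE (z : R * R) (n : int) : z.1 = n%:~R -> F_V p q z = mod2 ((capacity n)%:~R / W).
Proof.
move=> E; rewrite /F_V E PPE /capacity !intrM; congr mod2.
by field; exact: W_neq0.
Qed.

(** [N] is the intercept relative to n, the form in which the [cross_] lemmas enumerate the
    candidates. *)
Lemma light_Hseg (m n : int) (z : R * R) : light_point p q (Hseg m n) z <->
  exists2 N : int, lit w (mass (n + N)) (capacity n) & z.2 = n%:~R /\
   ((2 * p%:Z * m <= N * w <= 2 * p%:Z * (m + 1) /\ z.1 = (N * w)%:~R / (2 * p%:Z)%:~R) \/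
    (2 * q%:Z * m <= N * w <= 2 * q%:Z * (m + 1) /\ z.1 = (N * w)%:~R / (2 * q%:Z)%:~R)).
Proof.
have W0 := W_gt0.
have bnd (s : int) (x : R) N : 0 < s -> x = (N * w)%:~R / s%:~R ->
    (m%:~R <= x <= m%:~R + 1) = (s * m <= N * w <= s * (m + 1)).
  move=> s0 ->; rewrite ler_pdivlMr ?ltr0z // ler_pdivrMr ?ltr0z //.
  by rewrite -(intrD _ m 1) -!intrM !ler_int [m * s]mulrC [(m + 1) * s]mulrC.
have solve (s : nat) (N : int) : 0 < s%:Z -> z.2 = n%:~R ->
    z.2 + 2 * s%:R / W * z.1 = (n + N)%:~R <-> z.1 = (N * w)%:~R / (2 * s%:Z)%:~R.
  move=> s0 E2; have sR : (s%:R : R) != 0 by rewrite pnatr_eq0; lia.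
  rewrite E2 intrD !intrM; split=> [/addrI E|->].
    by rewrite -E; field; rewrite sR W_neq0.
  by congr (_ + _); field; rewrite sR W_neq0.
have q_gt0 : 0 < q%:Z by lia.
split=> [[/= [E2 hx] /(@light_on_line z (capacity n) _ (F_HE E2))[N L /= H]]|[N L /= [E2 H]]].
  have [N' EN] : exists N', N = n + N' by exists (N - n); ring.
  exists N'; first by rewrite -EN.
  split=> //; move: H; rewrite PPE QQE EN => -[/(solve _ _ p_gt0 E2)|/(solve _ _ q_gt0 E2)] H; [left|right].
    by split=> //; rewrite -(bnd _ z.1) //; lia.
  by split=> //; rewrite -(bnd _ z.1) //; lia.
split; rewrite /=; first by split=> //; case: H => [] [? /bnd ->] //; lia.
apply/(@light_on_line z (capacity n) _ (F_HE E2)); exists (n + N) => //; rewrite PPE QQE.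
by case: H => -[_]; [move/(solve _ _ p_gt0 E2); left|move/(solve _ _ q_gt0 E2); right].
Qed.

Lemma light_Vseg (m n : int) (z : R * R) : light_point p q (Vseg m n) z <->
  exists2 N : int, lit w (mass (n + N)) (capacity m) & z.1 = m%:~R /\
   ((0 <= N * w - 2 * p%:Z * m <= w /\ z.2 = n%:~R + (N * w - 2 * p%:Z * m)%:~R / W) \/
    (0 <= N * w - 2 * q%:Z * m <= w /\ z.2 = n%:~R + (N * w - 2 * q%:Z * m)%:~R / W)).
Proof.
have W0 := W_gt0.
have bnd (a : int) (x : R) : x = n%:~R + a%:~R / W ->
    (n%:~R <= x <= n%:~R + 1) = (0 <= a <= w).
  by move=> ->; rewrite lerDl lerD2l pmulr_lge0 ?invr_gt0 // ler_pdivrMr // mul1r ler_int ler0z.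
have solve (s : nat) (N : int) : z.1 = m%:~R ->
    z.2 + 2 * s%:R / W * z.1 = (n + N)%:~R <->
    z.2 = n%:~R + (N * w - 2 * s%:Z * m)%:~R / W.
  move=> E1; rewrite E1 intrD intrB !intrM; split=> [/(canRL (addrK _)) ->|->].
    by field; exact: W_neq0.
  by field; exact: W_neq0.
split=> [[/= [E1 hx] /(@light_on_line z (capacity m) _ (F_VE E1))[N L /= H]]|[N L /= [E1 H]]].
  have [N' EN] : exists N', N = n + N' by exists (N - n); ring.
  exists N'; first by rewrite -EN.
  split=> //; move: H; rewrite PPE QQE EN => -[] /(solve _ _ E1) H; [left|right].
    by split=> //; rewrite -(bnd _ z.2).
  by split=> //; rewrite -(bnd _ z.2).
split; rewrite /=; first by split=> //; case: H => [] [? /bnd ->].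
apply/(@light_on_line z (capacity m) _ (F_VE E1)); exists (n + N) => //; rewrite PPE QQE.
by case: H => [] [_ /(solve _ _ E1) H]; [left|right].
Qed.

Local Notation lp := (@light_point R p q).

Lemma good_light (s : useg) : good R p q s -> exists z, lp s z.
Proof.
rewrite /good /light_count => G; apply: contrapT => none.
have S0 : lp s = set0.
  by apply/seteqP; split=> // z zs; case: none; exists z.
have : ~ lp s (midpoint R s) by rewrite S0.
by move: G; rewrite S0 fset_set0 cardfs0; case: asboolP => //; rewrite andbF.
Qed.

(** The light count is b1 + b2, which is 1 exactly when the bits differ. *)
Lemma good_two_points (s : useg) (z1 z2 : R * R) (b1 b2 : bool) :
  (forall z, lp s z <-> (b1 /\ z = z1) \/ (b2 /\ z = z2)) ->
  z1 <> z2 -> ~ (is_horizontal s /\ lp s (midpoint R s)) ->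
  good R p q s <-> b1 (+) b2.
Proof.
move=> H z12 mid; rewrite /good /light_count.
have -> : is_horizontal s && `[< lp s (midpoint R s) >] = false.
  by apply/negP => /andP[hs /asboolP ls]; apply: mid.
rewrite addn0.
have -> : lp s = [set z | (b1 /\ z = z1) \/ (b2 /\ z = z2)].
  by apply/seteqP; split=> z /H.
case: b1 b2 {H} => [] [] /=.
- have -> : [set z | (true /\ z = z1) \/ (true /\ z = z2)] = z1 |` [set z2].
    by apply/seteqP; split=> z /= [H|H]; by [left; case: H|right; case: H|left|right].
  by rewrite fset_setU1 // fset_set1 cardfs2; move/eqP: z12 => ->.
- have -> : [set z | (true /\ z = z1) \/ (false /\ z = z2)] = [set z1].
    by apply/seteqP; split=> z /=; [case=> -[] | left].
  by rewrite fset_set1 cardfs1.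
- have -> : [set z | (false /\ z = z1) \/ (true /\ z = z2)] = [set z2].
    by apply/seteqP; split=> z /=; [case=> -[] | right].
  by rewrite fset_set1 cardfs1.
- have -> : [set z | (false /\ z = z1) \/ (false /\ z = z2)] = set0.
    by apply/seteqP; split=> z //= -[] [].
  by rewrite fset_set0 cardfs0.
Qed.

(** A light midpoint counts twice, so the light count is 0 or 2. *)
Lemma midpoint_not_good (s : useg) (b : bool) : is_horizontal s ->
  (forall z, lp s z <-> b /\ z = midpoint R s) -> ~ good R p q s.
Proof.
move=> hs H; rewrite /good /light_count hs.
have -> : lp s = [set z | b /\ z = midpoint R s].
  by apply/seteqP; split=> z /H.
case: b {H} => /=.
- have -> : [set z | true /\ z = midpoint R s] = [set midpoint R s].
    by apply/seteqP; split=> z /=; [case | ].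
  by rewrite fset_set1 cardfs1 asboolT.
- have -> : [set z | false /\ z = midpoint R s] = set0.
    by apply/seteqP; split=> z //= -[].
  by rewrite fset_set0 cardfs0 asboolF // => -[].
Qed.

Lemma divz_inj (a b s : int) : 0 < s -> a%:~R / s%:~R = b%:~R / s%:~R :> R -> a = b.
Proof.
by move=> s0 /(mulIf (invr_neq0 _)); rewrite intr_eq0 gt_eqF // => /(_ isT)/intr_inj.
Qed.

Lemma ratio_eq_int (a s m : int) : 0 < s -> a = s * m -> a%:~R / s%:~R = m%:~R :> R.
Proof. by move=> s0 ->; rewrite intrM mulrAC mulfV ?mul1r // intr_eq0 gt_eqF. Qed.

Lemma ratio_eq_half (a s m : int) : 0 < s ->
  a%:~R / (2 * s)%:~R = m%:~R + 2^-1 :> R <-> a = s * (2 * m + 1).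
Proof.
move=> s0; have sR : (s%:~R : R) != 0 by rewrite intr_eq0 gt_eqF.
split=> [E|->]; last by rewrite !intrM !intrD !intrM; field; exact: sR.
apply: (@intr_inj R); have -> : a%:~R = a%:~R / (2 * s)%:~R * (2 * s)%:~R :> R.
  by rewrite !intrM; field; exact: sR.
by rewrite E !intrM !intrD !intrM; field.
Qed.

(** The divisibility arises when a slanted line passes through the midpoint of a horizontal edge. It
    gives w | 2m + 1, and 0 < 2m + 1 < 2w leaves only the central column. *)
Lemma dvd_midpoint (m : int) : 0 <= m < w -> (w %| p%:Z * (2 * m + 1))%Z ->
  [/\ 2 * m + 1 = w, column_quo m = p%:Z - 1 & column_rem m = w - p%:Z].
Proof.
move=> hm /w_dvd/dvdzP[c Ec].
have c1 : c = 1.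
  have : 0 < c * w < 2 * w by lia.
  move=> H; have : 0 < c < 2 by clear -H w_gt0; nia.
  lia.
have mw : 2 * m + 1 = w by rewrite Ec c1 mul1r.
have [E rb] := column_quo_rem m.
have E' : 2 * p%:Z * m = (p%:Z - 1) * w + (w - p%:Z) by rewrite -mw; ring.
have : (column_quo m - (p%:Z - 1)) * w = (w - p%:Z) - column_rem m by rewrite mulrBl; lia.
have [e He] : exists e, column_quo m - (p%:Z - 1) = e by eexists.
rewrite He => H.
have e0 : e = 0.
  have : - w < e * w < w by lia.
  by move=> H'; clear -H' w_gt0; nia.
by rewrite e0 in H He; split=> //; lia.
Qed.

Lemma good_Vseg (m n : int) : good R p q (Vseg m n) <-> vgood m n.
Proof.
have W0 := W_gt0; have V0 := W_neq0.
have [E rb] := column_quo_rem m.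
have Vp := cross_Vp m.
have Vq := cross_Vq m.
have kr0P := column_rem_eq0 m.
(* With remainder 0 slanted lines pass through corners, but then the capacity is 0 and nothing is
   light. *)
case: (eqVneq (column_rem m) 0) => [/kr0P mw|r0].
  rewrite (vgood_capacity0 n mw); split=> // /good_light[z].
  by case/light_Vseg=> N; rewrite (lit_capacity0 _ (capacity_rep0 mw)).
pose zP := (m%:~R, n%:~R + ((column_quo m + 1) * w - 2 * p%:Z * m)%:~R / W) : R * R.
pose zQ := (m%:~R, n%:~R + ((2 * m - column_quo m) * w - 2 * q%:Z * m)%:~R / W) : R * R.
apply: (@good_two_points _ zP zQ).
- move=> z; split=> [/light_Vseg[N L [E1 H]]|].
    case: H => -[].
      move/Vp=> [NE|[_ h]] E2; last by rewrite h in r0.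
      left; split; first by rewrite -addrA -NE.
      by rewrite [z]surjective_pairing E1 E2 NE.
    move/Vq=> [NE|[_ h]] E2; last by rewrite h in r0.
    right; split; first by rewrite -addrA -NE.
    by rewrite [z]surjective_pairing E1 E2 NE.
  case=> -[L ->]; apply/light_Vseg.
    exists (column_quo m + 1); first by rewrite addrA.
    by split=> //; left; split=> //; apply/Vp; left.
  exists (2 * m - column_quo m); first by rewrite addrA.
  by split=> //; right; split=> //; apply/Vq; left.
(* With r = [column_rem m], the crossings are (w - r)/w and r/w above the lower end; they coincide
   only if w = 2r, but w is odd. *)
- case=> /addrI/(divz_inj w_gt0) H.
  have {}H : w = 2 * column_rem m by have := w_def; lia.
  by move: w_odd; rewrite H abszM oddM.
- by case.
Qed.

Lemma good_Hseg (m n : int) : 0 <= m < w -> good R p q (Hseg m n) <-> hgood m n.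
Proof.
move=> hm; have W0 := W_gt0; have V0 := W_neq0.
have q_gt0 : 0 < q%:Z by lia.
have p2_gt0 : 0 < 2 * p%:Z by lia.
have q2_gt0 : 0 < 2 * q%:Z by lia.
have [E rb] := column_quo_rem m.
have Hp := cross_Hp m.
have Hq := cross_Hq m.
pose zQ (j : int) := (((2 * m - column_quo m + j) * w)%:~R / (2 * q%:Z)%:~R, n%:~R) : R * R.
pose zP := (((column_quo m + 1) * w)%:~R / (2 * p%:Z)%:~R, n%:~R) : R * R.
have zQ_mid j : zQ j = midpoint R (Hseg m n) -> (w %| p%:Z * (2 * m + 1))%Z.
  case=> /(ratio_eq_half _ _ q_gt0) H; apply/dvdzP; exists (2 * m + 1 - (2 * m - column_quo m + j)).
  by rewrite mulrBl H; have := w_def; lia.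
rewrite /hgood; case: ifP => h.
  apply: (@good_two_points _ (zQ 0) (zQ 1)).
  - move=> z; split=> [/light_Hseg[N L [E2 H]]|].
      case: H => -[].
        move/Hp=> [[NE h']|[NE r0]] E1.
          (* A P-line meets the second Q-line at the corner (m + 1, n). Their masses add up to the
             capacity modulo [2 * w], so by [lit_sym] both are light or neither is, and they give
             the one point [zQ 1]. *)
          have rE : column_rem m = w - 2 * p%:Z by lia.
          have mw := column_rem_max rE.
          right; split.
            rewrite -(@lit_sym _ w_gt0 (mass (n + N)) _ _ (2 * p%:Z * ((m + 1) %/ w)%Z + 1)) //.
            have mE : m + 1 = ((m + 1) %/ w)%Z * w by rewrite divzK.
            rewrite /mass /capacity NE.
            have -> : 2 * p%:Z * (n + (column_quo m + 1)) + w + (2 * p%:Z * (n + 2 * m - column_quo m + 1) + w) =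
               4 * p%:Z * n + 4 * p%:Z * (m + 1) + 2 * w by ring.
            by rewrite {1}mE; ring.
          rewrite [z]surjective_pairing E1 E2 NE /zQ; congr (_, _).
          rewrite (@ratio_eq_int _ _ (m + 1)) ?(@ratio_eq_int _ _ (m + 1)) //; first by rewrite w_def in E rE *; lia.
          by rewrite rE in E; lia.
        (* In column 0 the P-line and the Q-line through (0, n) have the same intercept, so both
           give [zQ 0]. *)
        have mw : (w %| m)%Z by apply/(column_rem_eq0).
        have m0 : m = 0.
          case/dvdzP: mw => c Ec; have : 0 <= c < 1 by clear -Ec hm; nia.
          by move=> hc; rewrite Ec (_ : c = 0) ?mul0r //; lia.
        have k0 : column_quo m = 0 by rewrite /column_quo m0 mulr0 div0z.
        left; split; first by rewrite NE k0 m0 in L *; rewrite mulr0 subr0.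
        by rewrite [z]surjective_pairing E1 E2 NE /zQ k0 m0 mulr0 subr0 addr0 mul0r !mul0r.
      move/Hq=> [NE|[NE _]] E1; [left|right].
        by split; [rewrite -addrA -NE | rewrite [z]surjective_pairing E1 E2 NE /zQ addr0].
      by split; [rewrite -!addrA [2 * m + _]addrA -NE | rewrite [z]surjective_pairing E1 E2 NE /zQ].
    case=> -[L ->]; apply/light_Hseg.
      exists (2 * m - column_quo m); first by rewrite addrA.
      by split=> //; right; split; [apply/Hq; left | rewrite /zQ addr0].
    exists (2 * m - column_quo m + 1); first by rewrite !addrA.
    by split=> //; right; split; [apply/Hq; right | rewrite /zQ].
  - by case=> /(divz_inj q2_gt0); rewrite addr0 mulrDl; lia.
  (* A light midpoint would force remainder w - p, beyond the bound w - 2p of this case. *)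
  - case=> _ /light_Hseg[N _ [_ H]].
    have /(dvd_midpoint hm)[_ _ r] : (w %| p%:Z * (2 * m + 1))%Z.
      case: H => -[_ /esym].
        by move/(ratio_eq_half _ _ p_gt0) => <-; apply/dvdzP; exists N.
      move/(ratio_eq_half _ _ q_gt0) => H; apply/dvdzP; exists (2 * m + 1 - N).
      by rewrite mulrBl H; have := w_def; lia.
    by move: h; rewrite r; lia.
have lightP z : lp (Hseg m n) z <->
  (lit w (mass (n + column_quo m + 1)) (capacity n) /\ z = zP) \/
  (lit w (mass (n + 2 * m - column_quo m)) (capacity n) /\ z = zQ 0).
  split=> [/light_Hseg[N L [E2 H]]|].
    case: H => -[].
      move/Hp=> [[NE _]|[_ r0]] E1; last by move: h; rewrite r0; have := w_def; lia.
      by left; split; [rewrite -addrA -NE | rewrite [z]surjective_pairing E1 E2 NE].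
    move/Hq=> [NE|[_ r0]] E1; last by rewrite r0 in h.
    by right; split; [rewrite -addrA -NE | rewrite [z]surjective_pairing E1 E2 NE /zQ addr0].
  case=> -[L ->]; apply/light_Hseg.
    exists (column_quo m + 1); first by rewrite addrA.
    by split=> //; left; split; [apply/Hp; left; split=> //; lia | ].
  exists (2 * m - column_quo m); first by rewrite addrA.
  by split=> //; right; split; [apply/Hq; left | rewrite /zQ addr0].
(* Both lines of the second case pass through the midpoint exactly when 2m + 1 = w;
   the light count is then 0 or 2. *)
case: (boolP (w %| p%:Z * (2 * m + 1))%Z) => [dw|/negP ndw].
  have [mw k r] := dvd_midpoint hm dw.
  have b12 : lit w (mass (n + column_quo m + 1)) (capacity n) = lit w (mass (n + 2 * m - column_quo m)) (capacity n).
    apply: (@lit_sym _ w_gt0 _ _ _ (p%:Z + 1)).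
    rewrite /mass /capacity -[in RHS]mw.
    have -> : 2 * p%:Z * (n + column_quo m + 1) + w + (2 * p%:Z * (n + 2 * m - column_quo m) + w) =
      4 * p%:Z * n + 2 * p%:Z * (2 * m + 1) + 2 * w by ring.
    by rewrite -[in LHS]mw; ring.
  rewrite b12 addbb; split=> // G; exfalso.
  apply: (@midpoint_not_good (Hseg m n) (lit w (mass (n + 2 * m - column_quo m)) (capacity n))) G => // z.
  rewrite lightP b12.
  have -> : zP = midpoint R (Hseg m n).
    by congr (_, _); apply/(ratio_eq_half _ _ p_gt0); rewrite k mw; ring.
  have -> : zQ 0 = midpoint R (Hseg m n).
    congr (_, _); apply/(ratio_eq_half _ _ q_gt0); rewrite k mw.
    have -> : 2 * m = w - 1 by lia.
    have -> : q%:Z = w - p%:Z by rewrite w_def; ring.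
    by ring.
  by split=> [[]|]; [ | | left].
have zP_mid : zP = midpoint R (Hseg m n) -> (w %| p%:Z * (2 * m + 1))%Z.
  by case=> /(ratio_eq_half _ _ p_gt0) <-; apply/dvdzP; exists (column_quo m + 1).
apply: (good_two_points lightP).
(* With k = [column_quo m], coinciding crossings give (k + 1)q = (2m - k)p, that is (k + 1)w = p(2m
   + 1): the excluded midpoint case. *)
- case; rewrite addr0 => H; apply: ndw; apply/dvdzP; exists (column_quo m + 1).
  have : (column_quo m + 1) * q%:Z = (2 * m - column_quo m) * p%:Z; last by rewrite w_def; lia.
  apply: (@intr_inj R); move: H; rewrite !intrM => H.
  have pR : (p%:~R : R) != 0 by rewrite intr_eq0; lia.
  have qR : (q%:~R : R) != 0 by rewrite intr_eq0; lia.
  have -> : (column_quo m + 1)%:~R * q%:~R = ((column_quo m + 1)%:~R * W / (2%:~R * p%:~R)) * (2 * p%:~R * q%:~R) / W :> R.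
    by field; rewrite pR V0.
  by rewrite H; field; rewrite qR V0.
- by case=> _ /lightP[] [_ /esym]; [move/zP_mid | move/zQ_mid].
Qed.

(** * Reflection in the horizontal midline *)

Definition reflect_seg (s : useg) : useg :=
  match s with
  | Hseg m n => Hseg m (w - n)
  | Vseg m n => Vseg m (w - n - 1)
  end.

Definition reflect_pt (z : R * R) : R * R := (z.1, W - z.2).

Lemma reflect_segK : involutive reflect_seg.
Proof. by case=> m n /=; [congr Hseg | congr Vseg]; ring. Qed.

Lemma reflect_ptK : involutive reflect_pt.
Proof. by case=> x y; rewrite /reflect_pt /=; congr (_, _); ring. Qed.

Lemma reflect_midpoint (s : useg) :
  midpoint R (reflect_seg s) = reflect_pt (midpoint R s).
Proof.
by case: s => m n; rewrite /reflect_pt /= ?intrB; congr (_, _) => //; field.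
Qed.

(** On a horizontal edge [N] is kept, while modulo [2 * w] the capacity is negated and the mass
    becomes mass - capacity: [lit_sym], then [lit_opp], where parity keeps the capacity away from w.
    On a vertical edge the capacity is kept and, as P + Q = 2, P-lines and Q-lines are exchanged. *)
Lemma light_reflect (s : useg) (z : R * R) :
  lp s z -> lp (reflect_seg s) (reflect_pt z).
Proof.
have V0 := W_neq0.
case: s => m n; rewrite /reflect_seg /reflect_pt.
  case/light_Hseg=> N L [E2 H]; apply/light_Hseg; exists N; last by rewrite /= E2 intrB.
  have capE : capacity (w - n) = - capacity n + 2 * w * (2 * p%:Z) by rewrite /capacity; ring.
  have massE : mass (w - n + N) = - (capacity n - mass (n + N)) + 2 * w * p%:Z.
    by rewrite /capacity /mass; ring.
  rewrite capE massE lit_add //; apply: (@lit_opp w w_gt0).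
    have /negP en := even_capacity n; apply/eqP=> H'.
    by have [d Ed] := centered_repE w (capacity n); apply: en; rewrite Ed H'; move: w_odd; clear; lia.
  by rewrite -(@lit_sym _ w_gt0 (mass (n + N)) _ _ 0) // mulr0 addr0 addrC subrK.
case/light_Vseg=> N L [E1 H]; apply/light_Vseg; exists (2 * m + 1 - N).
  rewrite -(@lit_sym _ w_gt0 (mass (n + N)) _ _ (p%:Z + 1)) //.
  by rewrite /capacity /mass; ring.
have qE : (q%:Z)%:~R = W - (p%:Z)%:~R by rewrite w_def intrD; ring.
split=> //=; case: H => -[hN ->]; [right|left]; split; try by move: hN; rewrite w_def; lia.
  by rewrite !(intrB, intrD, intrM) qE; field.
by rewrite !(intrB, intrD, intrM) qE; field.
Qed.

Lemma good_reflect (s : useg) : good R p q s -> good R p q (reflect_seg s).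
Proof.
rewrite /good /light_count => <-.
have E : lp (reflect_seg s) = reflect_pt @` lp s.
  apply/seteqP; split=> z; last by case=> z' /light_reflect H <-.
  move/light_reflect; rewrite reflect_segK => H.
  by exists (reflect_pt z); rewrite ?reflect_ptK.
have hE : is_horizontal (reflect_seg s) = is_horizontal s by case: (s).
congr (_ + _)%N; last first.
  rewrite hE; congr (_ && _); apply/asboolP/asboolP => /light_reflect.
    by rewrite reflect_midpoint reflect_segK reflect_ptK.
  by rewrite reflect_midpoint.
rewrite E; have inj := inv_inj reflect_ptK.
case: (pselect (finite_set (lp s))) => fin.
  by rewrite fset_set_image // card_imfset.
(* [fset_set] of an infinite set is empty by convention, so the image must be infinite too. *)
rewrite /fset_set; case: pselect => [fin'|_]; last by case: pselect.
case: fin; rewrite -[lp s](image_id).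
have -> : (id : R * R -> R * R) = reflect_pt \o reflect_pt.
  by apply/funext => z /=; rewrite reflect_ptK.
by rewrite -image_comp; exact: finite_image.
Qed.

(** * Plaid polygons *)

Local Notation U := (@plaid_union R p q).

Lemma closed_segment_connected (a b : R * R) : connected (closed_segment a b).
Proof.
pose f (t : R) : R * R := ((1 - t) * a.1 + t * b.1, (1 - t) * a.2 + t * b.2).
have -> : closed_segment a b = f @` `[0, 1].
  apply/seteqP; split=> z /= [t]; first by move=> t01 ->; exists t => //=; rewrite in_itv.
  by rewrite in_itv /= => t01 <-; exists t.
apply: connected_continuous_connected; first exact: segment_connected.
have lin (c d : R) : continuous (fun t : R => (1 - t) * c + t * d).
  move=> t; apply: cvgD; apply: cvgM.
  - by apply: cvgB; [exact: cvg_cst | exact: cvg_id].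
  - exact: cvg_cst.
  - exact: cvg_id.
  - exact: cvg_cst.
by apply: continuous_subspaceT => t; exact: cvg_pair (lin _ _ t) (lin _ _ t).
Qed.

Lemma component_edge (m n : int) (s : useg) : edge_of m n s -> good R p q s ->
  connected_component U (Defs.center R m n) (midpoint R s).
Proof.
move=> es gs; have segl : closed_segment (Defs.center R m n) (midpoint R s) (Defs.center R m n).
  by exists 0; [rewrite lexx ler01 | rewrite !mul0r !subr0 !mul1r !addr0 -surjective_pairing].
apply: (connected_component_max segl).
- by move=> z ?; exists m, n, s.
- exact: closed_segment_connected.
- by exists 1; [rewrite ler01 lexx | rewrite !subrr !mul0r !mul1r !add0r -surjective_pairing].
Qed.

(** On the way from a centre to a midpoint, the moving coordinate is an integer only at the end t =
    1. *)
Lemma int_between (i j : int) (t : R) : 0 <= t <= 1 ->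
  (i%:~R = j%:~R + 2^-1 + t * 2^-1 -> i = j + 1 /\ t = 1) /\
  (i%:~R = j%:~R + 2^-1 - t * 2^-1 -> i = j /\ t = 1).
Proof.
move=> t01; split=> E.
  have h1 : (j%:~R : R) < i%:~R by lra.
  have h2 : (i%:~R : R) <= (j + 1)%:~R by rewrite intrD; lra.
  move: h1 h2; rewrite ltr_int ler_int => h1 h2; have ij : i = j + 1 by lia.
  by split=> //; move: E; rewrite ij intrD; lra.
have h1 : (j%:~R : R) <= i%:~R by lra.
have h2 : (i%:~R : R) < (j + 1)%:~R by rewrite intrD; lra.
move: h1 h2; rewrite ltr_int ler_int => h1 h2; have ij : i = j by lia.
by split=> //; move: E; rewrite ij; lra.
Qed.

Lemma half_not_int (i j : int) : i%:~R <> j%:~R + 2^-1 :> R.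
Proof.
move=> E; have : (2 * i)%:~R = (2 * j + 1)%:~R :> R by rewrite intrD !intrM; lra.
by move/intr_inj; lia.
Qed.

(** This confines the passage of a component from one column to the next to midpoints of good
    edges. *)
Lemma union_vertical (m : int) (z : R * R) : U z -> z.1 = m%:~R ->
  exists2 n : int, good R p q (Vseg m n) & z = midpoint R (Vseg m n).
Proof.
case=> i [j [s [es gs] [t t01 ->]]] /=.
have [h1 h2] := int_between m i t01.
case: es gs => [->|[->|[->|->]]] /= gs E.
- by case: (@half_not_int m i); lra.
- by case: (@half_not_int m i); lra.
- have [-> t1] : m = i /\ t = 1 by apply: h2; lra.
  by exists j => //; rewrite t1; congr (_, _); ring.
- have [-> t1] : m = i + 1 /\ t = 1 by apply: h1; move: E; rewrite intrD; lra.
  by exists j => //; rewrite t1; congr (_, _); ring.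
Qed.

Lemma union_horizontal (n : int) (z : R * R) : U z -> z.2 = n%:~R ->
  exists2 m : int, good R p q (Hseg m n) & z = midpoint R (Hseg m n).
Proof.
case=> i [j [s [es gs] [t t01 ->]]] /=.
have [h1 h2] := int_between n j t01.
case: es gs => [->|[->|[->|->]]] /= gs E.
- have [-> t1] : n = j /\ t = 1 by apply: h2; lra.
  by exists i => //; rewrite t1; congr (_, _); ring.
- have [-> t1] : n = j + 1 /\ t = 1 by apply: h1; move: E; rewrite intrD; lra.
  by exists i => //; rewrite t1; congr (_, _); ring.
- by case: (@half_not_int n j); lra.
- by case: (@half_not_int n j); lra.
Qed.

Lemma connected_ivt (C : set (R * R)) (f : R * R -> R) (a b : R * R) (c : R) :
  connected C -> continuous f -> C a -> C b -> f a <= c <= f b ->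
  exists2 z, C z & f z = c.
Proof.
move=> cC cf Ca Cb hc.
have /connected_intervalP itv : connected (f @` C).
  by apply: connected_continuous_connected => //; exact: continuous_subspaceT.
have im x : C x -> (f @` C) (f x) by exists x.
by have [z Cz Ez] := itv _ _ (im a Ca) (im b Cb) c hc; exists z.
Qed.

Lemma fst_continuous : continuous (fst : R * R -> R).
Proof. by move=> z; exact: cvg_fst. Qed.

Lemma snd_continuous : continuous (snd : R * R -> R).
Proof. by move=> z; exact: cvg_snd. Qed.

Lemma not_good_Vseg (m n : int) : (w %| m)%Z -> ~ good R p q (Vseg m n).
Proof. by move=> mw /good_Vseg; rewrite (vgood_capacity0). Qed.

Lemma not_good_Hseg (m n : int) : (w %| n)%Z -> ~ good R p q (Hseg m n).
Proof.
move=> nw /good_light[z] /light_Hseg[N].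
by rewrite (lit_capacity0 _ (capacity_rep0 nw)).
Qed.

(** The sides of the block have capacity 0 and no good edge, and by the intermediate value theorem a
    component leaving the block would meet one of these lines. *)
Lemma component_in_block (a z : R * R) :
  0 < a.1 < W -> 0 < a.2 < W -> connected_component U a z ->
  0 < z.1 < W /\ 0 < z.2 < W.
Proof.
move=> a1 a2 Cz; have cC := @component_connected _ U a.
have Ca : connected_component U a a.
  apply: connected_component_refl; apply: contrapT => nUa.
  by move: Cz; rewrite connected_component_out.
have dvd0w (c : int) : c = 0 \/ c = w -> (w %| c)%Z by case=> ->.
have n1 y (c : int) : c = 0 \/ c = w -> connected_component U a y -> y.1 <> c%:~R.
  move=> /dvd0w cw /connected_component_sub /union_vertical H /H[n].
  by move/(not_good_Vseg cw).
have n2 y (c : int) : c = 0 \/ c = w -> connected_component U a y -> y.2 <> c%:~R.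
  move=> /dvd0w cw /connected_component_sub /union_horizontal H /H[n].
  by move/(not_good_Hseg cw).
split; apply/andP; split; rewrite ltNge; apply/negP => hz.
- have /(connected_ivt cC fst_continuous Cz Ca)[y Cy Ey] : z.1 <= 0 <= a.1 by lra.
  by apply: (n1 y 0) Cy _; [left | rewrite mulr0z].
- have /(connected_ivt cC fst_continuous Ca Cz)[y Cy Ey] : a.1 <= W <= z.1 by lra.
  by apply: (n1 y w) Cy _; [right |].
- have /(connected_ivt cC snd_continuous Cz Ca)[y Cy Ey] : z.2 <= 0 <= a.2 by lra.
  by apply: (n2 y 0) Cy _; [left | rewrite mulr0z].
- have /(connected_ivt cC snd_continuous Ca Cz)[y Cy Ey] : a.2 <= W <= z.2 by lra.
  by apply: (n2 y w) Cy _; [right |].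
Qed.

Lemma continuous_reflect : continuous reflect_pt.
Proof.
have snd' : continuous (fun z : R * R => W - z.2).
  by move=> z; apply: cvgB; [exact: cvg_cst | exact: snd_continuous].
by move=> z; exact: cvg_pair (@fst_continuous z) (snd' z).
Qed.

Lemma union_reflect (z : R * R) : U z -> U (reflect_pt z).
Proof.
case=> i [j [s [es gs] [t t01 ->]]].
exists i, (w - j - 1), (reflect_seg s).
  split; last exact: good_reflect.
  case: es => [->|[->|[->|->]]] /=.
  - by right; left; congr Hseg; ring.
  - by left; congr Hseg; ring.
  - by right; right; left.
  - by right; right; right.
exists t => //; rewrite reflect_midpoint /reflect_pt /=; congr (_, _).
by rewrite !intrB; field.
Qed.

(** The mirror image of the component is connected, lies in the union and contains [reflect_pt b],
    so it stays in the component. *)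
Lemma component_reflect (a b : R * R) : connected_component U a b ->
  connected_component U a (reflect_pt b) ->
  forall z, connected_component U a z -> connected_component U a (reflect_pt z).
Proof.
move=> Cb Crb z Cz; apply: (connected_component_trans Crb).
apply: (@connected_component_max _ U (reflect_pt @` connected_component U a)).
- by exists b.
- by move=> _ [y /connected_component_sub Uy <-]; exact: union_reflect.
- apply: connected_continuous_connected; first exact: component_connected.
  by apply: continuous_subspaceT => y; exact: continuous_reflect.
- by exists z.
Qed.

(** 2p is invertible modulo w; m is its inverse r or w - r, whichever is below w/2. *)
Lemma exists_capacity2 : exists m d eps : int,
  [/\ 0 < m, 2 * m < w, eps = 1 \/ eps = -1 & 2 * p%:Z * m = eps + w * d].
Proof.
have [u [v uv]] : exists u v : int, u * (2 * p%:Z) + v * w = 1.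
  have /coprimezP[[u v] /= uv] : coprimez (2 * p%:Z) w.
    (* If g is the gcd and w = cg, then w divides 2pc, hence c, which forces g = 1. *)
    rewrite /coprimez; have /dvdzP[b Eb] := dvdz_gcdl (2 * p%:Z) w.
    have /dvdzP[c Ec] := dvdz_gcdr (2 * p%:Z) w.
    have /dvdzP[e Ee] : (w %| c)%Z.
      apply: dvd_mul2p; apply/dvdzP; exists b.
      by rewrite Eb {2}Ec; ring.
    have c0 : c != 0 by apply: contraTneq w_gt0 => c0; rewrite Ec c0 mul0r.
    have /(mulfI c0) ge : c * (e * gcdz (2 * p%:Z) w) = c * 1.
      by rewrite mulr1 [RHS]Ee {2}Ec; ring.
    have : 0 <= gcdz (2 * p%:Z) w by [].
    move: (gcdz _ _) ge => g ge g0; have : 0 < g < 2.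
      by clear -ge g0; have [e0|e0] := lerP e 0; nia.
    by lia.
  by exists u, v.
have w0 : w != 0 by lia.
have E := divz_eq u w; have := modz_ge0 u w0; have := ltz_mod u w0.
move: (u %/ w)%Z (u %% w)%Z E => a r E; rewrite gtr0_norm // => r1 r0.
have rE : 2 * p%:Z * r = 1 + w * (- v - 2 * p%:Z * a) by move: uv; rewrite E; lia.
have r_neq0 : r != 0.
  apply/eqP => r00; move: rE; rewrite r00 mulr0.
  by move: (_ - _) => t; have := w_odd; have := w_def; clear -p_gt0 p_lt_q => *; nia.
case: (ltP (2 * r) w) => h.
  by exists r, (- v - 2 * p%:Z * a), 1; split=> //; [lia | left].
exists (w - r), (2 * p%:Z + v + 2 * p%:Z * a), (-1); split; [lia | | by right |].
  by have : 2 * r != w; [have := w_odd; clear; lia | lia].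
by rewrite mulrBr rE; ring.
Qed.

Lemma union_center (m n : int) (s : useg) : edge_of m n s -> good R p q s ->
  U (Defs.center R m n).
Proof.
move=> es gs; apply: connected_component_sub.
exact: connected_component_sym (component_edge es gs).
Qed.

Lemma component_adjacent (a : R * R) (m n m' n' : int) (s : useg) :
  edge_of m n s -> edge_of m' n' s -> good R p q s ->
  `[< connected_component U a (Defs.center R m n) >] =
  `[< connected_component U a (Defs.center R m' n') >].
Proof.
move=> es es' gs; have H := component_edge es gs; have H' := component_edge es' gs.
apply: asbool_equiv_eq; split=> Ha; apply: (connected_component_trans Ha).
  exact: connected_component_trans H (connected_component_sym H').
exact: connected_component_trans H' (connected_component_sym H).
Qed.

(** * Parity of the crossings of a component with the grid lines *)

Section Component.
Variable a : R * R.
Let N : nat := (p + q)%N.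
Let k (i j : nat) := `[< connected_component U a (Defs.center R i%:Z j%:Z) >].

Let wN : w = N%:Z. Proof. by rewrite w_def PoszD. Qed.

Let next (i : nat) : i.+1%:Z = i%:Z + 1. Proof. by rewrite -addn1 PoszD. Qed.

Let kV (i j : nat) : (i.+1 < N)%N -> (j < N)%N -> vgood i.+1%:Z j%:Z -> k i j = k i.+1 j.
Proof.
move=> _ _ /good_Vseg; rewrite next; apply: component_adjacent.
  by right; right; right.
by rewrite next; right; right; left.
Qed.

Let kH (i j : nat) : (i < N)%N -> (j.+1 < N)%N -> hgood i%:Z j.+1%:Z -> k i j = k i j.+1.
Proof.
move=> iN _ g; have /good_Hseg g' : 0 <= i%:Z < w by rewrite wN; lia.
move/g': g; rewrite next; apply: component_adjacent; first by right; left.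
by rewrite next; left.
Qed.

(** A good edge is attributed to the component through the centre of the square above it. *)
Lemma horizontal_even (j : nat) : (j < p + q)%N ->
  \big[addb/false]_(i < p + q)
    (`[< connected_component U a (Defs.center R i%:Z j%:Z) >] && hgood i%:Z j%:Z) = false.
Proof.
apply: (@addb_line_even N k (fun i j => vgood i%:Z j%:Z) (fun i j => hgood i%:Z j%:Z)).
- by move=> i l _ _; rewrite !next; apply: (square_even).
- exact: kV.
- exact: kH.
- by move=> l; apply: (vgood_capacity0); rewrite dvdz0.
- by move=> l; apply: (vgood_capacity0); rewrite wN dvdzz.
- by move=> l; apply: (hgood_capacity0); rewrite dvdz0.
Qed.

(** The same sum with rows and columns exchanged; [square_even] is symmetric in the two kinds of
    edges. *)
Lemma vertical_even (i : nat) : (i < p + q)%N ->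
  \big[addb/false]_(j < p + q)
    (`[< connected_component U a (Defs.center R i%:Z j%:Z) >] && vgood i%:Z j%:Z) = false.
Proof.
apply: (@addb_line_even N (fun j i => k i j) (fun j i => hgood i%:Z j%:Z) (fun j i => vgood i%:Z j%:Z)).
- move=> l j _ _; rewrite !next.
  rewrite -[RHS](square_even j%:Z l%:Z).
  by case: (vgood _ _) (vgood _ _) (hgood _ _) (hgood _ _) => [] [] [] [].
- by move=> l j h1 h2; exact: kH.
- by move=> l j h1 h2; exact: kV.
- by move=> l; apply: (hgood_capacity0); rewrite dvdz0.
- by move=> l; apply: (hgood_capacity0); rewrite wN dvdzz.
- by move=> l; apply: (vgood_capacity0); rewrite dvdz0.
Qed.
End Component.

(** * The polygon through the first good edge of the row y = m *)

Section LongPolygon.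
Variables m d eps : int.
Hypothesis m_gt0 : 0 < m.
Hypothesis m_lt : 2 * m < w.
Hypothesis eps1 : eps = 1 \/ eps = -1.
Hypothesis m_def : 2 * p%:Z * m = eps + w * d.
Local Notation a := (Defs.center R 0 m).
Local Notation C := (connected_component U a).
Local Notation f := (w * w %/ (2 * q%:Z))%Z.

Lemma long_polygon_start : good R p q (Hseg 0 m).
Proof.
apply/good_Hseg; first by lia.
exact: (hgood_capacity2_0 eps1 m_def).
Qed.

Lemma long_polygon_union : U a.
Proof. by apply: union_center long_polygon_start; left. Qed.

Lemma long_polygon_in_block (z : R * R) : C z -> 0 < z.1 < W /\ 0 < z.2 < W.
Proof.
have m0 : (0 : R) < m%:~R by rewrite ltr0z.
have m1 : (m + 1)%:~R <= W :> R by rewrite ler_int; lia.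
have w1 : 1%:~R <= W :> R by rewrite ler_int; lia.
rewrite intrD in m1.
by apply: component_in_block => /=; [rewrite mulr0z|]; lra.
Qed.

(** From q < w < 2q, the crossing w^2/2q lies strictly between w/2 and w. *)
Lemma far_column_bounds : [/\ m <= f, f < w & (w * w)%:~R / (2 * q%:Z)%:~R - 1 <= f%:~R :> R].
Proof.
have q0 : 2 * q%:Z != 0 by lia.
have := divz_eq (w * w) (2 * q%:Z); have := modz_ge0 (w * w) q0.
have := ltz_mod (w * w) q0.
move: (_ %/ _)%Z (_ %% _)%Z => x r; rewrite gtr0_norm; last by lia.
move=> r1 r0 E; split.
- have := w_def; clear -p_gt0 p_lt_q r1 r0 E m_lt m_gt0 w_gt0 => wd; nia.
- have := w_def; clear -p_gt0 p_lt_q r1 r0 E w_gt0 => wd; nia.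
rewrite lerBlDr ler_pdivrMr; last by rewrite ltr0z; lia.
by rewrite -(intrD _ x 1) -intrM ler_int E; lia.
Qed.

(** The edge of column 0 is one crossing of y = m; parity yields another, and only column f is left
    for it. *)
Lemma long_polygon_far : C (Defs.center R f m).
Proof.
have m_lt_w : (`|m| < p + q)%N by have := w_def; lia.
have mE : m = `|m|%N%:Z by lia.
have n0 : (0 < p + q)%N by lia.
have [|i i0] := @addb_big_other _ _ (Ordinal n0) (horizontal_even a m_lt_w);
  rewrite -mE; last case/andP=> /asboolP Ci gi.
  rewrite /=; apply/andP; split; last by apply/good_Hseg; [lia | exact: long_polygon_start].
  by apply/asboolP; apply: connected_component_refl long_polygon_union.
have iw : 0 <= (i : nat)%:Z < w by have := ltn_ord i; rewrite w_def; lia.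
have [i00|<-] := hgood_capacity2 eps1 m_def iw gi; last by [].
case/eqP: i0; apply: val_inj => /=. lia.
Qed.

(** Running from column 0 to column f, with m at most f, the polygon crosses x = m, and by parity a
    second time. *)
Lemma long_polygon_reflect : exists j : int,
  C (midpoint R (Vseg m j)) /\ C (reflect_pt (midpoint R (Vseg m j))).
Proof.
have [mf _ _] := far_column_bounds.
have [z Cz zm] : exists2 z, C z & z.1 = m%:~R.
  apply: (connected_ivt _ fst_continuous _ long_polygon_far).
  - exact: component_connected.
  - exact: connected_component_refl long_polygon_union.
  - have : (m%:~R : R) <= f%:~R by rewrite ler_int.
    have : (1%:~R : R) <= m%:~R by rewrite ler_int; lia.
    by rewrite /= mulr0z; lra.
have [j gj zE] := union_vertical (connected_component_sub Cz) zm.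
exists j; rewrite zE in Cz; split=> //.
have inC (l : int) : good R p q (Vseg m l) -> C (midpoint R (Vseg m l)) -> C (Defs.center R m l).
  move=> gl Cl; apply: (connected_component_trans Cl).
  by apply: connected_component_sym; apply: component_edge => //; right; right; left.
have j_bound : 0 <= j < w.
  have [_] := long_polygon_in_block Cz; rewrite /= => hj.
  have : (0 : R) < (j + 1)%:~R by rewrite intrD; lra.
  have : (j%:~R : R) < W by lra.
  by rewrite ltr0z ltr_int; lia.
have jE : j = `|j|%N%:Z by lia.
have m_lt_w : (`|m| < p + q)%N by have := w_def; lia.
have j_lt_w : (`|j| < p + q)%N by have := w_def; lia.
have mE : m = `|m|%N%:Z by lia.
have [|i ij] := @addb_big_other _ _ (Ordinal j_lt_w) (vertical_even a m_lt_w);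
  rewrite -mE; last case/andP=> /asboolP Ci gi.
  by rewrite /= -jE; apply/andP; split; [apply/asboolP; exact: inC | apply/good_Vseg].
have i_bound : 0 <= (i : nat)%:Z < w by have := ltn_ord i; rewrite w_def; lia.
have gr := good_reflect gj; rewrite -reflect_midpoint.
have r_bound : 0 <= w - j - 1 < w by lia.
have Cmid (l : int) : C (Defs.center R m l) -> good R p q (Vseg m l) -> C (midpoint R (Vseg m l)).
  move=> Cl gl; apply: (connected_component_trans Cl).
  by apply: component_edge => //; right; right; left.
have /good_Vseg gj' := gj; have /good_Vseg gr' := gr.
(* Of the good edges i, j and the mirror image of j, two agree; as i differs from j, the mirror
   image is i or j, both on the component. *)
have := vgood_capacity2 eps1 m_def i_bound j_bound r_bound gi gj' gr'.
rewrite /reflect_seg; case=> [ijE|<-|<-] //.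
- by case/eqP: ij; apply/val_inj => /=; lia.
- by apply: Cmid => //; apply/good_Vseg.
Qed.

Lemma long_polygon : [/\ plaid_polygon p q C,
  C `<=` @first_block R p q,
  (((omega R p q) ^+ 2 / (2 * q%:R) - 1)%:E <= x_diameter C)%E &
  forall z : R * R, C z <-> C (z.1, omega R p q - z.2)].
Proof.
rewrite !omegaE; split.
- by exists a => //; exact: long_polygon_union.
- by move=> z /long_polygon_in_block[/andP[? ?] /andP[? ?]]; rewrite /first_block /= omegaE !ltW.
- have [_ _ hf] := far_column_bounds.
  apply: (@le_trans _ _ (f%:~R)%:E).
    by rewrite lee_fin; move: hf; rewrite !intrM expr2.
  apply: ereal_sup_ubound; exists (Defs.center R f m); first exact: long_polygon_far.
  exists a; first exact: connected_component_refl long_polygon_union.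
  rewrite /= mulr0z add0r addrK ger0_norm //.
  have [mf _ _] := far_column_bounds; rewrite ler0z; lia.
- have [j [Cj Crj]] := long_polygon_reflect.
  have refl := component_reflect Cj Crj.
  move=> z; split; first exact: refl.
  by move/refl; rewrite -[(z.1, _)]/(reflect_pt z) reflect_ptK.
Qed.
End LongPolygon.

End Plaid.

Theorem theorem4p3 (R : realType) (p q : nat) :
  (0 < p)%N -> (p < q)%N -> coprime p q -> ~~ odd (p * q) ->
  exists C : set (R * R),
    [/\ plaid_polygon p q C,
        C `<=` @first_block R p q,
        (((@omega R p q) ^+ 2 / (2 * q%:R) - 1)%:E <= x_diameter C)%E &
        forall z : R * R, C z <-> C (z.1, @omega R p q - z.2)].
Proof.
move=> p0 pq co ev.
have p_gt0 : 0 < p%:Z by lia.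
have p_lt_q : p%:Z < q%:Z by lia.
(* Exactly one of p and q is even. *)
have w_odd : odd `|(p%:Z + q%:Z)%R|%N.
  rewrite -PoszD absz_nat oddD; move: ev; rewrite oddM negb_and.
  have [op|ep] := boolP (odd p); first by case: (odd q).
  have [//|eq _] := boolP (odd q).
  have : (2 %| gcdn p q)%N by rewrite dvdn_gcd !dvdn2 ep eq.
  by rewrite (eqP co).
have w_dvd x : (p%:Z + q%:Z %| p%:Z * x)%Z -> (p%:Z + q%:Z %| x)%Z.
  rewrite Gauss_dvdzr // /coprimez -PoszD.
  by rewrite /gcdz !absz_nat gcdnC gcdnDl; apply/eqP; rewrite (eqP co).
have [m [d [eps [m0 mw eps1 md]]]] :=
  exists_capacity2 erefl p_gt0 p_lt_q w_odd w_dvd.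
eexists; exact: (long_polygon erefl p_gt0 p_lt_q w_odd w_dvd R m0 mw eps1 md).
Qed.
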